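(* (i) For every $n\geq 4$ and every $G\in\mathcal{GAQ}_n$, $G$ is fractional strongly maximally matched, i.e. $fsmp(G)=2n-1$. (ii) For every $n\geq 4$ and every $G\in\mathcal{RGAQ}_n$, $G$ is fractional strongly super matched.
   Context: The $n$-dimensional augmented cube $AQ_n$ ($n\geq 1$) has vertex set all binary strings $u_1u_2\cdots u_n$. $AQ_1\cong K_2$ on vertices $0,1$. For $n\geq 2$, $AQ_n$ consists of a copy $AQ^0_{n-1}$ of $AQ_{n-1}$ with $0$ prefixed to every label and a copy $AQ^1_{n-1}$ with $1$ prefixed, plus the following edges: $0u_1\cdots u_{n-1}$ is adjacent to $1v_1\cdots v_{n-1}$ iff either $u_i=v_i$ for all $i$ (cross edge) or $u_i\neq v_i$ for all $i$ (complement edge). Generalized augmented cubes: $\mathcal{GAQ}_4=\{AQ_4\}$; for $n\geq 5$, $\mathcal{GAQ}_n$ consists of all graphs $(V_1\cup V_2, E_1\cup E_2\cup M_1\cup M_2)$ where $(V_1,E_1),(V_2,E_2)$ are (vertex-disjoint copies of, possibly identical) graphs in $\mathcal{GAQ}_{n-1}$ and $M_1,M_2$ are edge-disjoint perfect matchings between $V_1$ and $V_2$; such graphs are $(2n-1)$-regular on $2^n$ vertices. Restricted generalized a-cubes: $\mathcal{RGAQ}_4=\{AQ_4\}$; for $n\geq 5$, $\mathcal{RGAQ}_n$ consists of all graphs obtained as in the definition of $\mathcal{GAQ}_n$ from $G_1,G_2\in\mathcal{GAQ}_{n-1}$ with the additional requirement that the edge set $M_1\cup M_2$ contains neither a 4-cycle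 nor a 6-cycle. For $F\subseteq V(G)\cup E(G)$, $G-F$ denotes $G$ with the vertices and edges of $F$ deleted. A fractional perfect matching of $G$ is $f:E(G)\to[0,1]$ with $\sum_{e\ni v}f(e)=1$ for every vertex $v$. A fractional strong matching preclusion (FSMP) set is $F\subseteq V(G)\cup E(G)$ with $G-F$ having no fractional perfect matching; $fsmp(G)$ is the minimum size of an FSMP set, and an FSMP set of that size is optimal. $G$ is fractional strongly maximally matched if $fsmp(G)=\delta(G)$, and fractional strongly super matched if in addition $G-F$ has an isolated vertex for every optimal FSMP set $F$. *)

(* Defs.v *)
From Stdlib Require Import Rdefinitions.
From HB Require Import structures.
From mathcomp Require Import all_boot.

Set Implicit Arguments.
Unset Strict Implicit.
Unset Printing Implicit Defensive.

Definition all_differ (u v : seq bool) : bool := all2 (fun a b => a != b) u v.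

(* adjacency of AQ_n on bit strings (first letter = prefix bit):
   aq [a] [b] = (a != b)  (AQ_1 = K_2);
   0u ~ 0v iff u ~ v in AQ_{n-1}, same for 1;
   0u ~ 1v iff u = v (cross edge) or u,v differ everywhere (complement edge). *)
Fixpoint aq (u v : seq bool) : bool :=
  match u, v with
  | a :: u', b :: v' =>
      if a == b then aq u' v' else (u' == v') || all_differ u' v'
  | _, _ => false
  end.

Definition AQrel (n : nat) : rel (n.-tuple bool) := fun x y => aq x y.

Definition isoAQ (n : nat) (T : finType) (e : rel T) : Prop :=
  exists f : T -> n.-tuple bool, bijective f /\ forall x y, e x y = AQrel (f x) (f y).

Definition subrel (T : finType) (A : {set T}) (e : rel T) : rel {x : T | x \in A} :=
  fun x y => e (val x) (val y).
Arguments subrel {T} A e.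

(* A graph is a finite type T with an adjacency relation e.
   GAQ step: V = A (disjoint union) ~:A, G[A], G[~:A] in GAQ_{n-1},
   the edges between A and ~:A are exactly M1 u M2 where M1, M2 are the
   perfect matchings given by bijections g1, g2 : A -> ~:A with g1 x <> g2 x
   (edge-disjointness). *)
Inductive isGAQ : nat -> forall T : finType, rel T -> Prop :=
| GAQ_base (T : finType) (e : rel T) : isoAQ 4 e -> isGAQ 4 e
| GAQ_step (n : nat) (T : finType) (e : rel T) (A : {set T})
    (g1 g2 : {x : T | x \in A} -> {x : T | x \in ~: A}) :
    isGAQ n (subrel A e) ->
    isGAQ n (subrel (~: A) e) ->
    bijective g1 -> bijective g2 ->
    (forall x, g1 x != g2 x) ->
    symmetric e ->
    (forall (x : {x : T | x \in A}) (y : {x : T | x \in ~: A}),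
        e (val x) (val y) = (g1 x == y) || (g2 x == y)) ->
    isGAQ n.+1 e.

Definition has_cycle (T : finType) (k : nat) (h : rel T) : Prop :=
  exists s : seq T, size s = k /\ uniq s /\ cycle h s.

Definition isRGAQ (n : nat) (T : finType) (e : rel T) : Prop :=
  (n = 4 /\ isoAQ 4 e) \/
  (exists m : nat, n = m.+1 /\ 4 <= m /\
   exists (A : {set T}) (g1 g2 : {x : T | x \in A} -> {x : T | x \in ~: A}),
    [/\ isGAQ m (subrel A e), isGAQ m (subrel (~: A) e),
        bijective g1, bijective g2 & (forall x, g1 x != g2 x)] /\
    symmetric e /\
    (forall (x : {x : T | x \in A}) (y : {x : T | x \in ~: A}),
        e (val x) (val y) = (g1 x == y) || (g2 x == y)) /\
    let M := fun x y => e x y && ((x \in A) != (y \in A)) in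
    ~ has_cycle 4 M /\ ~ has_cycle 6 M).

(* A set F of vertices and edges is a pair (FV, FE); edges are 2-sets {x,y}. *)
Definition valid_F (T : finType) (e : rel T) (FE : {set {set T}}) : Prop :=
  forall S, S \in FE -> exists x y, e x y /\ S = [set x; y].

Definition del_rel (T : finType) (e : rel T) (FV : {set T}) (FE : {set {set T}}) : rel T :=
  fun x y => [&& e x y, x \notin FV, y \notin FV & [set x; y] \notin FE].

Definition has_fpm (T : finType) (W : {set T}) (h : rel T) : Prop :=
  exists f : T -> T -> R,
    (forall x y, f x y = f y x) /\
    (forall x y, h x y -> Rle R0 (f x y) /\ Rle (f x y) R1) /\
    (forall x, x \in W -> \big[Rplus/R0]_(y | h x y) f x y = R1).

Definition FSMP_set (T : finType) (e : rel T) (FV : {set T}) (FE : {set {set T}}) : Prop :=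
  valid_F e FE /\ ~ has_fpm (~: FV) (del_rel e FV FE).

Definition fsmp_is (T : finType) (e : rel T) (k : nat) : Prop :=
  (exists FV FE, FSMP_set e FV FE /\ #|FV| + #|FE| = k) /\
  (forall FV FE, FSMP_set e FV FE -> k <= #|FV| + #|FE|).

Definition min_degree (T : finType) (e : rel T) : nat :=
  \big[minn/#|T|]_(x : T) #|[set y | e x y]|.

Definition frac_strongly_max_matched (T : finType) (e : rel T) : Prop :=
  fsmp_is e (min_degree e).

Definition frac_strongly_super_matched (T : finType) (e : rel T) : Prop :=
  frac_strongly_max_matched e /\
  forall k, fsmp_is e k ->
  forall FV FE, FSMP_set e FV FE -> #|FV| + #|FE| = k ->
    exists x, x \notin FV /\ forall y, ~~ del_rel e FV FE x y.

(* Main.v *)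
(* By Hall's theorem on the bipartite double cover, [G - F] has no fractional
   perfect matching iff some independent set [I] of [G - F] has fewer than
   [#|I|] neighbours. The cheapest [F] with this effect deletes the [e(I)] edges
   of [G] inside [I] and all but [#|I| - 1] of its [b(I)] boundary vertices. It
   remains to bound this cost [e(I) + max(0, b(I) - #|I| + 1)] below by the
   degree [d] for every nonempty [I], and by [d + 1] when [#|I| >= 2] for super
   matchedness.

   Since the graph is [d]-regular, the bound [d] on the cost implies
   [e(I) + b(I) - #|I| + 2 >= d] even where the maximum is 0. Summing this over
   the two halves of [G] settles the sets meeting both of them. A set inside one
   half gains its partners under the two matchings as boundary vertices: at
   least [max(2, #|I|)] of them, and at least 3 if [#|I| = 2] and the matchings
   form no 4-cycle. For AQ_4 the bound is checked by exhaustion. *)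

Require Import Defs.
From Stdlib Require Import Reals Lra.
From mathcomp Require Import all_boot fingroup perm zify Rstruct.

Set Implicit Arguments.
Unset Strict Implicit.
Unset Printing Implicit Defensive.

Delimit Scope R_scope with coqR.

(** * Hall's theorem and fractional perfect matchings *)

Section Neighbourhood.
Variables (S T : finType).
Implicit Types (r : S -> T -> bool) (X : {set S}).

Definition nbhd r X : {set T} := [set y | [exists x in X, r x y]].

Lemma nbhdP r X y : reflect (exists2 x, x \in X & r x y) (y \in nbhd r X).
Proof. by rewrite inE; apply: exists_inP. Qed.

End Neighbourhood.

Section Hall.
Variables (S T : finType).
Implicit Types (E : {set S * T}) (X : {set S}).

Definition hall_condition (r : S -> T -> bool) :=
  [forall X : {set S}, #|X| <= #|nbhd r X|].

Definition rel_of E (x : S) (y : T) := (x, y) \in E.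

Lemma mem_nbhd_del E X x y w u : w \in X -> (w, u) \in E ->
  (w != x) || (u != y) -> u \in nbhd (rel_of (E :\ (x, y))) X.
Proof.
move=> wX wuE neq; apply/nbhdP; exists w => //.
by rewrite /rel_of !inE wuE andbT xpair_eqE negb_and.
Qed.

Lemma hall_violation_del E x y : hall_condition (rel_of E) ->
    ~~ hall_condition (rel_of (E :\ (x, y))) ->
  exists2 X : {set S}, x \in X & #|nbhd (rel_of (E :\ (x, y))) X| < #|X|.
Proof.
move=> /forallP hallE /forallPn[X]; rewrite -ltnNge => ltX; exists X => //.
apply: contraLR ltX => xX; rewrite -leqNgt (leq_trans (hallE X)) //.
apply/subset_leq_card/subsetP=> u /nbhdP[w wX wuE].
by rewrite (mem_nbhd_del wX wuE) // (memPn xX).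
Qed.

(* If both arcs at [x] were removable only at the expense of the sets [X] and
   [Y], submodularity of [#|nbhd _|] would contradict Hall's condition for
   [X :|: Y] and [(X :&: Y) :\ x]. *)
Lemma minimal_hall_functional E x y z :
    minset (fun E => hall_condition (rel_of E)) E ->
  (x, y) \in E -> (x, z) \in E -> y = z.
Proof.
case/minsetP=> hallE minE xyE xzE; apply/eqP; apply: contraT => yz.
have violated u : (x, u) \in E ->
    exists2 X : {set S}, x \in X & #|nbhd (rel_of (E :\ (x, u))) X| < #|X|.
  move=> xuE; apply: hall_violation_del => //; apply/negP => /minE.
  by move/(_ (subD1set _ _))/setP/(_ (x, u)); rewrite !inE eqxx xuE.
have [X xX] := violated y xyE; have [Y xY] := violated z xzE.
set NY := nbhd _ Y; set NX := nbhd _ X => ltY ltX.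
have subU : nbhd (rel_of E) (X :|: Y) \subset NX :|: NY.
  apply/subsetP=> u /nbhdP[w wXY wuE]; apply/setUP; have [wx|wx] := eqVneq w x.
    have [uy|uy] := eqVneq u y; [right|left]; apply: mem_nbhd_del wuE _.
    - by rewrite wx.
    - by rewrite uy yz orbT.
    - by rewrite wx.
    - by rewrite uy orbT.
  by case/setUP: wXY => w_in; [left|right]; apply: mem_nbhd_del w_in wuE _;
    rewrite wx.
have subI : nbhd (rel_of E) ((X :&: Y) :\ x) \subset NX :&: NY.
  apply/subsetP=> u /nbhdP[w /setD1P[wx /setIP[wX wY]] wuE]; apply/setIP.
  by split; [apply: mem_nbhd_del wX wuE _|apply: mem_nbhd_del wY wuE _];
    rewrite wx.
have := forallP hallE (X :|: Y); have := forallP hallE ((X :&: Y) :\ x).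
have := subset_leq_card subU; have := subset_leq_card subI.
have := cardsUI NX NY; have := cardsUI X Y.
have := cardsD1 x (X :&: Y); rewrite inE xX xY.
by lia.
Qed.

Theorem hall (r : S -> T -> bool) : hall_condition r ->
  exists2 f : S -> T, injective f & forall x, r x (f x).
Proof.
move=> hallr; pose Er := [set p | r p.1 p.2].
have hallEr : hall_condition (rel_of Er).
  apply/forallP=> X; apply: leq_trans (forallP hallr X) _.
  apply/subset_leq_card/subsetP=> y /nbhdP[x xX rxy].
  by apply/nbhdP; exists x; rewrite // /rel_of inE.
have [E minE sE] :=
  @minset_exists _ (fun E => hall_condition (rel_of E)) Er hallEr.
have /forallP hallE := minsetp minE.
have [f fE] : exists f : S -> T, forall x, (x, f x) \in E.
  apply: (@fin_all_exists _ (fun=> T) (fun x y => (x, y) \in E)) => x.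
  have := hallE [set x]; rewrite cards1.
  by case/card_gt0P=> y /nbhdP[_ /set1P->]; exists y.
exists f => [x y fxy|x]; last by have := subsetP sE _ (fE x); rewrite inE.
apply: contraTeq (hallE [set x; y]) => xy; rewrite -ltnNge cards2 xy /= ltnS.
rewrite -(cards1 (f x)) subset_leq_card //; apply/subsetP=> u /nbhdP[w wxy wu].
rewrite inE (minimal_hall_functional minE wu (fE w)).
by case/set2P: wxy => ->; rewrite -?fxy.
Qed.

End Hall.

Section FractionalPerfectMatching.
Variables (T : finType) (W : {set T}) (h : rel T).
Hypothesis symh : symmetric h.

Lemma deficient_independent (X : {set T}) : #|nbhd h X| < #|X| ->
  exists I : {set T}, [/\ I \subset X, {in I &, forall x y, ~~ h x y} &
    #|nbhd h I| < #|I|].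
Proof.
move=> ltX; exists (X :\: nbhd h X); split; first exact: subsetDl.
  move=> x y /setDP[xX _] /setDP[_ yN]; apply: contra yN => hxy.
  by apply/nbhdP; exists x.
have subN : nbhd h (X :\: nbhd h X) \subset nbhd h X :\: X.
  apply/subsetP=> u /nbhdP[y /setDP[yX yN] hyu]; apply/setDP; split.
    by apply/nbhdP; exists y.
  by apply: contra yN => uX; apply/nbhdP; exists u; rewrite // symh.
have := subset_leq_card subN.
have := cardsID X (nbhd h X); have := cardsID (nbhd h X) X.
by rewrite setIC; lia.
Qed.

(* Every arc [x -> s x] carries weight 1/2. *)
Lemma has_fpm_perm (s : {perm T}) :
  {in W, forall x, h x (s x) && h x ((s^-1)%g x)} -> has_fpm W h.
Proof.
move=> hs; pose a x y : R := if s x == y then (/ 2)%coqR else R0.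
have a_half x y : (0 <= a x y <= / 2)%coqR by rewrite /a; case: ifP => _; lra.
exists (fun x y => (a x y + a y x)%coqR); split=> [x y|].
  exact: Rplus_comm.
split=> [x y _|x xW]; first by move: (a_half x y) (a_half y x); lra.
have /andP[hsx hVx] := hs x xW.
have half z : h x z ->
    \big[Rplus/R0]_(y | h x y) (if z == y then / 2 else 0)%coqR = (/ 2)%coqR.
  move=> hxz; rewrite -big_mkcondr (big_pred1 z) // => y /=.
  by rewrite [z == y]eq_sym; case: eqVneq => [->|_]; rewrite ?hxz ?andbF.
rewrite big_split /= half //.
rewrite (eq_bigr (fun y => if (s^-1)%g x == y then / 2 else 0)%coqR) => [|y _].
  by rewrite half //; lra.
by rewrite /a eq_sym -(canF_eq (permKV s)).
Qed.

(* A perfect matching of the bipartite double cover is a permutation, which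
   exists by Hall's theorem once every vertex outside [W] gets a loop. *)
Lemma no_fpm_deficient_independent :
    (forall x y, h x y -> y \in W) -> ~ has_fpm W h ->
  exists I : {set T}, [/\ I \subset W, {in I &, forall x y, ~~ h x y} &
    #|nbhd h I| < #|I|].
Proof.
move=> hW nofpm; pose looped x y := h x y || (x == y) && (x \notin W).
have [/hall[s injs sP]|] := boolP (hall_condition looped).
  case: nofpm; apply: (@has_fpm_perm (perm injs)) => x xW.
  set t := perm injs; have tP y : looped y (t y) by rewrite permE.
  have := tP x; rewrite /looped xW andbF orbF => ->.
  have := tP ((t^-1)%g x); rewrite /looped permKV symh => /orP[->//|].
  by case/andP=> /eqP->; rewrite xW.
case/forallPn=> Y; rewrite -ltnNge => ltY.
have [|I [sIX indI ltI]] := @deficient_independent (Y :&: W); last first.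
  by exists I; split=> //; apply: subset_trans sIX (subsetIr _ _).
have subN : nbhd h (Y :&: W) :|: Y :\: W \subset nbhd looped Y.
  apply/subsetP=> y /setUP[/nbhdP[x /setIP[xY _] hxy]|/setDP[yY yW]];
    apply/nbhdP.
    by exists x; rewrite // /looped hxy.
  by exists y; rewrite // /looped eqxx yW orbT.
have disjN : nbhd h (Y :&: W) :&: (Y :\: W) = set0.
  apply/setP=> y; rewrite in_setI in_setD in_set0; apply/negP.
  by case/and3P=> /nbhdP[x _ /hW ->].
have := subset_leq_card subN; rewrite cardsU disjN cards0.
by have := cardsID W Y; lia.
Qed.

End FractionalPerfectMatching.

(** * Preclusion costs *)

Section Graph.
Variables (T : finType) (e : rel T).
Hypotheses (symE : symmetric e) (irrE : irreflexive e).
Implicit Types (A B I : {set T}).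

Definition degree_in A x := #|[set y in A | e x y]|.

Definition regular_on d A := {in A, forall x, degree_in A x = d}.

Definition induced_edges I : {set {set T}} :=
  [set [set x; y] | x in I, y in I & e x y].

Definition boundary A I := (A :\: I) :&: nbhd e I.

(* The least number of vertices and edges to delete from the subgraph induced
   by [A] so that [I] becomes independent with fewer neighbours than vertices:
   all edges inside [I] and, beyond the first [#|I| - 1], all its boundary
   vertices (none if the subtraction truncates). *)
Definition preclusion_cost A I :=
  #|induced_edges I| + (#|boundary A I|.+1 - #|I|).

Definition robust k d A :=
  forall I, I \subset A -> k <= #|I| -> d <= preclusion_cost A I.

Lemma induced_edgesP I (S : {set T}) :
  reflect (exists x y, [/\ x \in I, y \in I, e x y & S = [set x; y]])
          (S \in induced_edges I).
Proof.
apply: (iffP imset2P) => [[x y xI]|[x [y [xI yI exy ->]]]].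
  by rewrite inE => /andP[yI exy] ->; exists x, y.
by exists x y; rewrite // inE yI.
Qed.

Lemma induced_edgesS A B :
  A \subset B -> induced_edges A \subset induced_edges B.
Proof.
move=> /subsetP sAB; apply/subsetP=> S /induced_edgesP[x [y [xA yA exy ->]]].
by apply/induced_edgesP; exists x, y; split; rewrite ?sAB.
Qed.

Lemma induced_edges_subset I S : S \in induced_edges I -> S \subset I.
Proof.
by case/induced_edgesP=> x [y [xI yI _ ->]]; rewrite subUset !sub1set xI.
Qed.

Lemma boundaryP A I y :
  reflect [/\ y \in A, y \notin I & exists2 x, x \in I & e x y]
          (y \in boundary A I).
Proof.
rewrite in_setI in_setD -andbA andbCA.
by apply: (iffP and3P) => -[-> -> h]; split=> //; apply/nbhdP.
Qed.

Lemma set2_injr (x : T) : injective (fun y => [set x; y]).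
Proof.
move=> y z E; have : y \in [set x; z] by rewrite -E set22.
case/set2P=> // yx; have : z \in [set x; y] by rewrite E set22.
by rewrite yx => /set2P[].
Qed.

Lemma card_incident_edges I x :
  x \in I -> #|[set S in induced_edges I | x \in S]| = degree_in I x.
Proof.
move=> xI; rewrite /degree_in -(card_imset _ (@set2_injr x)).
apply: eq_card => S.
apply/setIdP/imsetP => [[/induced_edgesP[y [z [yI zI eyz ->]]]]|[y]].
  case/set2P=> ->; [exists z|exists y] => //; rewrite ?inE ?zI ?yI //.
    by rewrite symE.
  by rewrite setUC.
rewrite inE => /andP[yI exy] ->; rewrite set21; split=> //.
by apply/induced_edgesP; exists x, y.
Qed.

Lemma card_induced_edgesU1 I x :
  x \notin I -> #|induced_edges (x |: I)| = degree_in I x + #|induced_edges I|.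
Proof.
move=> xI; rewrite -(cardsID [set S : {set T} | x \in S] (induced_edges _)).
congr (_ + _).
  rewrite -setIdE card_incident_edges ?setU11 //; apply: eq_card => y.
  by rewrite !inE; case: eqVneq => // ->; rewrite irrE (negPf xI).
apply: eq_card => S; apply/setDP/idP => [[]|SI].
  case/induced_edgesP=> y [z [yxI zxI eyz ->]]; rewrite !inE => /norP[xy xz].
  apply/induced_edgesP; exists y, z; split=> //.
    by case/setU1P: yxI xy => // ->; rewrite eqxx.
  by case/setU1P: zxI xz => // ->; rewrite eqxx.
split; first exact: (subsetP (induced_edgesS (subsetUr _ _))).
by rewrite inE; apply: contra xI; apply/subsetP/induced_edges_subset.
Qed.

Lemma handshake I : \sum_(x in I) degree_in I x = 2 * #|induced_edges I|.
Proof.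
have incE x : x \in I ->
    degree_in I x = \sum_(S in induced_edges I) (x \in S : nat).
  move=> xI; rewrite -card_incident_edges // -sum1_card -big_mkcondr.
  by apply: eq_bigl => S; rewrite inE.
rewrite (eq_bigr _ incE) exchange_big mulnC -sum_nat_const.
apply: eq_bigr => S SI; rewrite -big_mkcondr sum1_card; transitivity #|S|.
  apply: eq_card => x; rewrite unfold_in /= andb_idl //.
  by apply/subsetP/induced_edges_subset.
case/induced_edgesP: SI => x [y [_ _ exy ->]]; rewrite cards2.
by case: eqVneq exy => // ->; rewrite irrE.
Qed.

Lemma sum_degree_in A B :
  \sum_(x in A) degree_in B x = \sum_(y in B) degree_in A y.
Proof.
have degE C x : degree_in C x = \sum_(y in C) (e x y : nat).
  by rewrite -big_mkcondr sum1_card; apply: eq_card => y; rewrite !inE.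
rewrite (eq_bigr _ (fun x _ => degE B x)) exchange_big /=.
by apply: eq_bigr => y _; rewrite degE; apply: eq_bigr => x _; rewrite symE.
Qed.

Lemma degree_inS A B x : A \subset B -> degree_in A x <= degree_in B x.
Proof.
move=> /subsetP sAB; apply/subset_leq_card/subsetP=> y.
by rewrite !inE => /andP[/sAB-> ->].
Qed.

(* Each boundary vertex absorbs at most [d] of the edges leaving [I]. *)
Lemma regular_volume_le d A I : regular_on d A -> I \subset A ->
  d * #|I| <= 2 * #|induced_edges I| + d * #|boundary A I|.
Proof.
move=> regA sIA; have -> : d * #|I| = \sum_(x in I) degree_in A x.
  rewrite mulnC -sum_nat_const; apply: eq_bigr => x xI.
  by rewrite regA // (subsetP sIA).
rewrite sum_degree_in (big_setID I) /= (setIidPr sIA) handshake leq_add2l.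
rewrite (big_setID (nbhd e I)) /= [X in _ + X]big1 => [|y /setDP[_ yN]].
  rewrite addn0 mulnC -sum_nat_const; apply: leq_sum => y /boundaryP[yA _ _].
  by rewrite -(regA y yA) degree_inS.
apply/eqP; rewrite cards_eq0 -subset0; apply/subsetP=> x.
rewrite inE => /andP[xI eyx]; case/nbhdP: yN.
by exists x; rewrite // symE.
Qed.

Lemma regular_degree_lt d A I x : regular_on d A -> I \subset A -> x \in I ->
  d < #|I| + #|boundary A I|.
Proof.
move=> regA sIA xI; rewrite -(regA x (subsetP sIA _ xI)).
rewrite (cardsD1 x I) xI add1n addSn ltnS -cardsUI.
apply: leq_trans (leq_addr _ _); apply/subset_leq_card/subsetP=> y.
rewrite inE => /andP[yA exy]; rewrite in_setU in_setD1.
have [yI|yI] := boolP (y \in I).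
  by rewrite andbT; case: eqVneq exy => // ->; rewrite irrE.
by rewrite andbF /=; apply/boundaryP; split=> //; exists x.
Qed.

Lemma robust_singleton d A : regular_on d A -> robust 2 d.+1 A -> robust 1 d A.
Proof.
move=> regA robA I sIA I_gt0; have [I_gt1|I_le1] := ltnP 1 #|I|.
  exact/ltnW/robA.
have [x xI] := card_gt0P I_gt0; have := regular_degree_lt regA sIA xI.
by rewrite /preclusion_cost; lia.
Qed.

(* If [#|I|] exceeds [#|boundary A I|] by [c >= 2], then regularity gives
   [#|induced_edges I| >= d * c / 2 >= d + c - 2]. *)
Lemma robust_excess d A I : regular_on d A -> robust 1 d A -> 1 < d ->
    I \subset A -> 0 < #|I| ->
  d + #|I| <= #|induced_edges I| + #|boundary A I| + 2.
Proof.
move=> regA robA d_gt1 sIA I_gt0.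
have := robA I sIA I_gt0; rewrite /preclusion_cost.
have [|gap _] := leqP #|I| #|boundary A I|.+1; first by lia.
have := regular_volume_le regA sIA; have := subnKC (ltnW gap).
set c := #|I| - _ => <-; have : 0 < c by rewrite subn_gt0.
by nia.
Qed.

End Graph.

(** * Fractional strong matching preclusion in robust regular graphs *)

Section Preclusion.
Variables (T : finType) (e : rel T).
Hypotheses (symE : symmetric e) (irrE : irreflexive e).

Section Deletion.
Variables (FV : {set T}) (FE : {set {set T}}).
Local Notation h := (del_rel e FV FE).

Lemma del_rel_sym : symmetric h.
Proof.
by move=> x y; rewrite /del_rel symE setUC; congr (_ && _); rewrite andbCA.
Qed.

Lemma del_relE x y : x \notin FV -> y \notin FV ->
  h x y = e x y && ([set x; y] \notin FE).
Proof. by move=> xF yF; rewrite /del_rel xF yF. Qed.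

Section Violator.
Variable I : {set T}.
Hypotheses (sIFV : I \subset ~: FV) (indI : {in I &, forall x y, ~~ h x y}).
Hypothesis ltI : #|nbhd h I| < #|I|.

Let survives x : x \in I -> x \notin FV.
Proof. by move/(subsetP sIFV); rewrite inE. Qed.

Lemma induced_edges_deleted : induced_edges e I \subset FE.
Proof.
apply/subsetP=> S /induced_edgesP[x [y [xI yI exy ->]]].
by have := indI xI yI; rewrite del_relE ?survives // exy negbK.
Qed.

(* Each boundary vertex that survives without a neighbour in [I] is cut off by
   a deleted edge, which it shares with no other vertex outside [I]. *)
Lemma card_boundary_deleted :
  #|boundary e setT I :\: (FV :|: nbhd h I)| <= #|FE :\: induced_edges e I|.
Proof.
rewrite -(card_imset _ set1_inj).
apply: leq_trans (leq_imset_card (fun S => S :\: I) _).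
apply/subset_leq_card/subsetP=> _ /imsetP[y /setDP[yB yN] ->].
case/boundaryP: yB => _ yI [x xI exy]; move: yN; rewrite inE => /norP[yF yN].
apply/imsetP; exists [set x; y]; last first.
  apply/setP=> z; rewrite !inE; have [->|_] := eqVneq z y.
    by rewrite yI orbT.
  by case: eqVneq => [->|]; rewrite ?xI ?andbF.
apply/setDP; split.
  apply: contraNT yN => xyF; apply/nbhdP; exists x => //.
  by rewrite (del_relE (survives xI) yF) exy.
apply: contra yI => /induced_edges_subset/subsetP; apply.
exact: set22.
Qed.

Lemma preclusion_cost_deleted : preclusion_cost e setT I <= #|FV| + #|FE|.
Proof.
have := card_boundary_deleted; have := cardsD FE (induced_edges e I).
rewrite (setIidPr induced_edges_deleted) /preclusion_cost.
have := subset_leq_card induced_edges_deleted.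
have := cardsID (FV :|: nbhd h I) (boundary e setT I).
have := subset_leq_card (subsetIr (boundary e setT I) (FV :|: nbhd h I)).
have := cardsU FV (nbhd h I).
by move: ltI; lia.
Qed.

End Violator.

Lemma FSMP_set_cost : FSMP_set e FV FE ->
  exists I : {set T}, [/\ 0 < #|I|, preclusion_cost e setT I <= #|FV| + #|FE| &
    #|I| = 1 -> exists x, x \notin FV /\ forall y, ~~ h x y].
Proof.
case=> _ nofpm; have hW x y : h x y -> y \in ~: FV.
  by case/and4P=> _ _; rewrite inE.
have [I [sIFV indI ltI]] := no_fpm_deficient_independent del_rel_sym hW nofpm.
exists I; split; [exact: leq_ltn_trans ltI | exact: preclusion_cost_deleted |].
move/eqP/cards1P=> [x IE]; exists x; split.
  by have := subsetP sIFV x; rewrite IE !inE; apply.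
move: ltI; rewrite IE cards1 ltnS leqn0 cards_eq0 => /eqP N0 y.
apply: contraFN (in_set0 y) => hxy; rewrite -N0; apply/nbhdP.
by exists x; rewrite ?set11.
Qed.

End Deletion.

Variable d : nat.
Hypotheses (T_gt0 : 0 < #|T|) (regT : regular_on e d setT).

Lemma neighbours_FSMP_set x : FSMP_set e [set y | e x y] set0.
Proof.
split=> [S|[f [_ [_ /(_ x)]]]]; first by rewrite inE.
rewrite !inE irrE => /(_ isT); rewrite big_pred0 => [|y].
  by move/esym/R1_neq_R0.
by rewrite /del_rel !inE; case: (e x y); rewrite ?andbF.
Qed.

Lemma regular_card_neighbours x : #|[set y | e x y]| = d.
Proof. by rewrite -(regT (in_setT x)); apply: eq_card => y; rewrite !inE. Qed.

Lemma regular_min_degree : min_degree e = d.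
Proof.
rewrite /min_degree (eq_bigr _ (fun x _ => regular_card_neighbours x)).
rewrite big_const.
have [x _] := card_gt0P T_gt0.
have dT : d <= #|T| by rewrite -(regular_card_neighbours x) max_card.
have d_le_iter k : d <= iter k (minn d) #|T|.
  by elim: k => //= k IHk; rewrite leq_min leqnn.
by case: #|T| T_gt0 d_le_iter => // m _ d_le_iter; apply/minn_idPl/d_le_iter.
Qed.

Lemma robust_fsmp_is : robust e 1 d setT -> fsmp_is e d.
Proof.
move=> robT; split.
  have [x _] := card_gt0P T_gt0; exists [set y | e x y], set0.
  rewrite cards0 addn0 regular_card_neighbours; split=> //.
  exact: neighbours_FSMP_set.
move=> FV FE /FSMP_set_cost[I [I_gt0 costI _]].
exact: leq_trans (robT I (subsetT I) I_gt0) costI.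
Qed.

Lemma robust_frac_strongly_max_matched :
  robust e 1 d setT -> frac_strongly_max_matched e.
Proof.
by rewrite /frac_strongly_max_matched regular_min_degree; apply: robust_fsmp_is.
Qed.

Lemma fsmp_is_inj k l : fsmp_is e k -> fsmp_is e l -> k = l.
Proof.
move=> [[FV [FE [F <-]]] min_k] [[FV' [FE' [F' <-]]] min_l].
by apply/eqP; rewrite eqn_leq min_k ?min_l.
Qed.

Lemma robust_frac_strongly_super_matched :
  robust e 2 d.+1 setT -> frac_strongly_super_matched e.
Proof.
move=> robT; have robT1 := robust_singleton irrE regT robT.
split=> [|k]; first exact: robust_frac_strongly_max_matched.
move/(fsmp_is_inj (robust_fsmp_is robT1)) <- => FV FE /FSMP_set_cost.
case=> I [I_gt0 costI isolated] Fd; apply: isolated; apply/eqP.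
rewrite eqn_leq I_gt0 andbT leqNgt; apply/negP => I_gt1.
by have := robT I (subsetT I) I_gt1; rewrite -Fd leqNgt ltnS costI.
Qed.

End Preclusion.

(** * Graphs doubled by two perfect matchings *)

Section Embedding.
Variables (T' T : finType) (e' : rel T') (e : rel T) (j : T' -> T).
Hypotheses (injj : injective j) (jE : forall x y, e' x y = e (j x) (j y)).
Implicit Types (A I : {set T'}).

Lemma degree_in_imset A x : degree_in e (j @: A) (j x) = degree_in e' A x.
Proof.
rewrite /degree_in -(card_imset _ injj); apply: eq_card => y.
apply/setIdP/imsetP => [[/imsetP[z zA ->] exz]|[z]].
  by exists z; rewrite // inE zA jE.
by rewrite inE => /andP[zA exz] ->; rewrite imset_f // -jE.
Qed.

Lemma card_induced_edges_imset I :
  #|induced_edges e (j @: I)| = #|induced_edges e' I|.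
Proof.
rewrite -(card_imset _ (imset_inj injj)); apply: eq_card => S.
apply/induced_edgesP/imsetP => [[_ [_ [/imsetP[x xI ->] /imsetP[y yI ->]]]]|].
  move=> exy ->; exists [set x; y]; last by rewrite imsetU1 imset_set1.
  by apply/induced_edgesP; exists x, y; rewrite jE.
case=> _ /induced_edgesP[x [y [xI yI exy ->]]] ->.
by exists (j x), (j y); rewrite !imset_f // -jE imsetU1 imset_set1.
Qed.

Lemma boundary_imset A I : boundary e (j @: A) (j @: I) = j @: boundary e' A I.
Proof.
apply/setP=> y; apply/boundaryP/imsetP.
  case=> /imsetP[z zA ->]; rewrite mem_imset // => zI [_ /imsetP[x xI ->]] exz.
  by exists z => //; apply/boundaryP; split=> //; exists x; rewrite // jE.
case=> z /boundaryP[zA zI [x xI exz]] ->; rewrite !mem_imset //; split=> //.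
by exists (j x); rewrite ?mem_imset // -jE.
Qed.

Lemma regular_on_imset d A : regular_on e' d A -> regular_on e d (j @: A).
Proof. by move=> regA _ /imsetP[x xA ->]; rewrite degree_in_imset regA. Qed.

Lemma robust_imset k d A : robust e' k d A -> robust e k d (j @: A).
Proof.
move=> robA I sIA.
have [J sJA ->] : exists2 J : {set T'}, J \subset A & I = j @: J.
  exists (j @^-1: I :&: A); first exact: subsetIr.
  apply/setP=> y; apply/idP/imsetP => [yI|[x /setIP[xJ _] ->]].
    have /imsetP[x xA yE] := subsetP sIA y yI.
    by exists x; rewrite // !inE -yE yI.
  by rewrite inE in xJ.
rewrite /preclusion_cost boundary_imset card_induced_edges_imset !card_imset //.
exact: robA.
Qed.

End Embedding.

Lemma imset_val_sig (T : finType) (A : {set T}) :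
  (val : {x | x \in A} -> T) @: setT = A.
Proof.
apply/setP=> x; apply/imsetP/idP => [[y _ ->]|xA]; first exact: (valP y).
by exists (exist _ x xA).
Qed.

Lemma regular_on_subrel (T : finType) (e : rel T) (A : {set T}) d :
  regular_on (Defs.subrel A e) d setT -> regular_on e d A.
Proof.
by move/(regular_on_imset val_inj (fun _ _ => erefl)); rewrite imset_val_sig.
Qed.

Lemma robust_subrel (T : finType) (e : rel T) (A : {set T}) k d :
  robust (Defs.subrel A e) k d setT -> robust e k d A.
Proof.
by move/(robust_imset val_inj (fun _ _ => erefl)); rewrite imset_val_sig.
Qed.

(* [p] and [q] are two perfect matchings between [A] and its complement, given
   as involutions of the whole vertex set so that the sides are symmetric. *)
Definition two_matchings (T : finType) (e : rel T) (A : {set T})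
    (p q : T -> T) :=
  [/\ involutive p /\ involutive q,
      forall x, p x != q x,
      forall x, (p x \in A) = (x \notin A),
      forall x, (q x \in A) = (x \notin A) &
      forall x y, (x \in A) != (y \in A) -> e x y = (p x == y) || (q x == y)].

Lemma two_matchings_setC (T : finType) (e : rel T) (A : {set T})
    (p q : T -> T) :
  two_matchings e A p q -> two_matchings e (~: A) p q.
Proof.
case=> invpq pq pA qA pqE; split=> // [x|x|x y]; rewrite !inE ?pA ?qA //.
by move=> xyA; apply: pqE; move: xyA; do 2!case: (_ \in A).
Qed.

Lemma matching_involution (T : finType) (A : {set T})
    (g : {x : T | x \in A} -> {x : T | x \in ~: A}) : bijective g ->
  exists p : T -> T, [/\ involutive p,
    forall x, (p x \in A) = (x \notin A) & forall u, p (val u) = val (g u)].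
Proof.
case=> g' gK g'K.
have outE (v : {x : T | x \in ~: A}) : val v \in A = false.
  by have := valP v; rewrite inE => /negPf.
pose p x := if insub x is Some u then val (g u)
  else if insub x is Some v then val (g' v) else x.
have p_left u : p (val u) = val (g u) by rewrite /p valK.
have p_right v : p (val v) = val (g' v) by rewrite /p insubF ?outE // valK.
have sideP x : (exists u : {x | x \in A}, x = val u) \/
    (exists v : {x | x \in ~: A}, x = val v).
  have [xA|xA] := boolP (x \in A); [left|right; rewrite -in_setC in xA].
    by exists (exist _ x xA).
  by exists (exist _ x xA).
exists p; split=> // x; case: (sideP x) => -[u ->].
- by rewrite p_left p_right gK.
- by rewrite p_right p_left g'K.
- by rewrite p_left outE (valP u).
by rewrite p_right (valP (g' u)) outE.
Qed.

Lemma two_matchings_exist (T : finType) (e : rel T) (A : {set T})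
    (g1 g2 : {x : T | x \in A} -> {x : T | x \in ~: A}) :
    bijective g1 -> bijective g2 -> (forall x, g1 x != g2 x) -> symmetric e ->
    (forall x y, e (val x) (val y) = (g1 x == y) || (g2 x == y)) ->
  exists p q, two_matchings e A p q.
Proof.
move=> /matching_involution[p [invp pA pE]].
move=> /matching_involution[q [invq qA qE]].
move=> g12 symE eE; exists p, q.
have pqE x y : x \in A -> y \notin A -> e x y = (p x == y) || (q x == y).
  move=> xA; rewrite -in_setC => yA.
  have := eE (exist _ x xA) (exist _ y yA); rewrite /= => ->.
  by rewrite -!val_eqE -pE -qE.
have pqA x : x \in A -> p x != q x.
  by move=> xA; have := g12 (exist _ x xA); rewrite -val_eqE -pE -qE.
split=> // [x|x y].
  have [/pqA //|xA] := boolP (x \in A).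
  have /pqA : p x \in A by rewrite pA.
  by rewrite invp; apply: contraNneq => pqx; rewrite pqx invq.
have [xA|xA] := boolP (x \in A); have [yA|yA] := boolP (y \in A);
  rewrite ?eqxx //= => _; first exact: pqE.
by rewrite symE pqE // (inv_eq invp) (inv_eq invq) ![y == _]eq_sym.
Qed.

Section Doubling.
Variables (T : finType) (e : rel T) (p q : T -> T).
Implicit Types (A I : {set T}).

Definition partners I := p @: I :|: q @: I.

(* The union of the two matchings contains no cycle [x - p x - y - q x - x]. *)
Definition square_free := forall x y, p x = q y -> q x <> p y.

Lemma partnersP I y :
  reflect (exists2 x, x \in I & (p x == y) || (q x == y)) (y \in partners I).
Proof.
apply: (iffP setUP) => [[]/imsetP[x xI ->]|[x xI]].
- by exists x; rewrite ?eqxx.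
- by exists x; rewrite ?eqxx ?orbT.
by case/orP=> /eqP<-; [left|right]; apply: imset_f.
Qed.

Lemma card_partners_ge I : injective p -> #|I| <= #|partners I|.
Proof.
by move=> injp; rewrite -(card_imset _ injp) subset_leq_card ?subsetUl.
Qed.

Lemma card_partners_gt1 I :
  (forall x, p x != q x) -> I != set0 -> 1 < #|partners I|.
Proof.
move=> pq /set0Pn[x xI]; apply: (@leq_trans #|[set p x; q x]|).
  by rewrite cards2 pq.
by rewrite subset_leq_card // subUset !sub1set !inE !imset_f ?orbT.
Qed.

Lemma card_partners_gt2 I : injective p -> injective q ->
    (forall x, p x != q x) -> square_free -> 1 < #|I| ->
  2 < #|partners I|.
Proof.
move=> injp injq pq sqpq /card_gt1P[x [y [xI yI xy]]].
apply: (@leq_trans #|partners [set x; y]|); last first.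
  have sxyI : [set x; y] \subset I by rewrite subUset !sub1set xI.
  by rewrite subset_leq_card // setUSS ?imsetS.
rewrite ltnNge; apply/negP => le_partners2.
have pN : p @: [set x; y] = partners [set x; y].
  by apply/eqP; rewrite eqEcard subsetUl card_imset // cards2 xy.
have qN z : z \in [set x; y] -> (q z == p x) || (q z == p y).
  move=> zxy; have : q z \in p @: [set x; y] by rewrite pN inE imset_f ?orbT.
  by rewrite imsetU1 imset_set1 !inE.
apply: (sqpq x y); apply/eqP.
  have := qN y (set22 _ _).
  by rewrite [_ == p y]eq_sym (negPf (pq y)) orbF eq_sym.
by have := qN x (set21 _ _); rewrite [_ == p x]eq_sym (negPf (pq x)).
Qed.

Hypotheses (symE : symmetric e) (irrE : irreflexive e).

Lemma degree_in_double A x : two_matchings e A p q -> x \in A ->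
  degree_in e setT x = (degree_in e A x).+2.
Proof.
case=> _ pq pA qA pqE xA; rewrite -addn2 {1}/degree_in.
rewrite -(cardsID A [set y in _ | _]); congr (_ + _).
  by apply: eq_card => y; rewrite !inE andbC.
transitivity #|[set p x; q x]|; last by rewrite cards2 pq.
apply: eq_card => y; rewrite !inE.
have [yA|yA] := boolP (y \in A).
  by apply/esym/norP; split; apply: contraTneq yA => ->; rewrite ?pA ?qA xA.
by rewrite pqE ?xA ?(negPf yA) // ![y == _]eq_sym.
Qed.

Lemma regular_on_double d A : two_matchings e A p q ->
  regular_on e d A -> regular_on e d (~: A) -> regular_on e d.+2 setT.
Proof.
move=> pqA regA regA' x _; have [xA|xA] := boolP (x \in A).
  by rewrite (degree_in_double pqA) // regA.
by rewrite (degree_in_double (two_matchings_setC pqA)) ?regA' // inE.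
Qed.

Lemma card_induced_edges_split A I :
  #|induced_edges e (I :&: A)| + #|induced_edges e (I :\: A)|
    <= #|induced_edges e I|.
Proof.
rewrite -cardsUI [X in _ + X](_ : _ = 0) ?addn0.
  by rewrite subset_leq_card // subUset !induced_edgesS ?subsetIl ?subsetDl.
apply/eqP; rewrite cards_eq0 -subset0; apply/subsetP=> S /setIP[].
case/induced_edgesP=> x [y [/setIP[_ xA] _ _ ->]] /induced_edges_subset.
by rewrite subUset !sub1set inE xA.
Qed.

Lemma card_boundary_split A I :
  #|boundary e A (I :&: A)| + #|boundary e (~: A) (I :\: A)|
    <= #|boundary e setT I|.
Proof.
rewrite -(cardsID A (boundary e setT I)).
apply: leq_add; apply/subset_leq_card/subsetP=> y /boundaryP[].
  move=> yA; rewrite inE yA andbT => yI [x /setIP[xI _] exy].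
  by apply/setIP; split=> //; apply/boundaryP; split=> //; exists x.
rewrite in_setC in_setD => yA; rewrite yA => yI [x /setDP[xI _] exy].
by apply/setDP; split=> //; apply/boundaryP; split=> //; exists x.
Qed.

Lemma card_boundary_one_side A I : two_matchings e A p q -> I \subset A ->
  #|boundary e A I| + #|partners I| <= #|boundary e setT I|.
Proof.
case=> _ _ pA qA pqE /subsetP sIA.
rewrite -(cardsID A (boundary e setT I)).
apply: leq_add; apply/subset_leq_card/subsetP=> y.
  by case/boundaryP=> yA yI xP; apply/setIP; split=> //; apply/boundaryP.
case/partnersP=> x xI pqx; have yA : y \notin A.
  by case/orP: pqx => /eqP<-; rewrite ?pA ?qA negbK sIA.
apply/setDP; split=> //; apply/boundaryP; split=> //.
  by apply: contra yA => /sIA.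
by exists x; rewrite // pqE // sIA // (negPf yA).
Qed.

Lemma preclusion_cost_one_side A d I : two_matchings e A p q -> 5 < d ->
    regular_on e d A -> robust e 1 d A -> I \subset A -> I != set0 ->
  d + minn 3 #|partners I| <= preclusion_cost e setT I.
Proof.
move=> pqA d_gt5 regA robA sIA /set0Pn[x xI].
have I_gt0 : 0 < #|I| by apply/card_gt0P; exists x.
have d_gt1 : 1 < d := ltn_trans (isT : 1 < 5) d_gt5.
have := regular_degree_lt irrE regA sIA xI.
have := robust_excess symE irrE regA robA d_gt1 sIA I_gt0.
have := robA I sIA I_gt0; have := card_boundary_one_side pqA sIA.
have [[/inv_inj injp _] _ _ _ _] := pqA; have := @card_partners_ge I injp.
by rewrite /preclusion_cost; lia.
Qed.

Section TwoHalves.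
Variables (A : {set T}) (d : nat).
Hypotheses (pqA : two_matchings e A p q) (d_gt5 : 5 < d).
Hypotheses (regA : regular_on e d A) (regA' : regular_on e d (~: A)).
Hypotheses (robA : robust e 1 d A) (robA' : robust e 1 d (~: A)).

Lemma preclusion_cost_two_sides I :
  I :&: A != set0 -> I :\: A != set0 -> d.+3 <= preclusion_cost e setT I.
Proof.
rewrite -!card_gt0 /preclusion_cost => inA outA.
have d_gt1 : 1 < d := ltn_trans (isT : 1 < 5) d_gt5.
have := robust_excess symE irrE regA robA d_gt1 (subsetIr I A) inA.
have sID : I :\: A \subset ~: A by rewrite setDE subsetIr.
have := robust_excess symE irrE regA' robA' d_gt1 sID outA.
have := card_induced_edges_split A I; have := card_boundary_split A I.
have := cardsID A I.
by lia.
Qed.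

Lemma preclusion_cost_double I : I != set0 ->
  d + minn 3 #|partners I| <= preclusion_cost e setT I.
Proof.
move=> I_neq0; have [out0|outA] := eqVneq (I :\: A) set0.
  apply: preclusion_cost_one_side pqA d_gt5 regA robA _ I_neq0.
  by rewrite -setD_eq0 out0.
have [in0|inA] := eqVneq (I :&: A) set0.
  have pqCA := two_matchings_setC pqA.
  apply: preclusion_cost_one_side pqCA d_gt5 regA' robA' _ I_neq0.
  by rewrite -disjoints_subset -setI_eq0 in0.
by have := preclusion_cost_two_sides inA outA; lia.
Qed.

Lemma robust_double : robust e 1 d.+2 setT.
Proof.
move=> I _; rewrite card_gt0 => I_neq0; have [_ pq _ _ _] := pqA.
have := preclusion_cost_double I_neq0.
by have := card_partners_gt1 pq I_neq0; lia.
Qed.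

Lemma robust_double_square_free : square_free -> robust e 2 d.+3 setT.
Proof.
move=> sqpq I _ I_gt1; have I_neq0 : I != set0 by rewrite -card_gt0 ltnW.
have [[/inv_inj injp /inv_inj injq] pq _ _ _] := pqA.
have := card_partners_gt2 injp injq pq sqpq I_gt1.
by have := preclusion_cost_double I_neq0; lia.
Qed.

End TwoHalves.

End Doubling.

Lemma no_4_cycle_square_free (T : finType) (e : rel T) (A : {set T})
    (p q : T -> T) :
    symmetric e -> two_matchings e A p q ->
    ~ has_cycle 4 (fun x y => e x y && ((x \in A) != (y \in A))) ->
  square_free p q.
Proof.
move=> symE [[invp invq] pq pA qA eE] no4 x y pxqy qxpy; apply: no4.
have crossp a : e a (p a) && ((a \in A) != (p a \in A)).
  by rewrite eE pA ?eqxx //; case: (a \in A).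
have crossq a : e a (q a) && ((a \in A) != (q a \in A)).
  by rewrite eE qA ?eqxx ?orbT //; case: (a \in A).
have crossqV a : e (q a) a && ((q a \in A) != (a \in A)).
  by rewrite symE eq_sym crossq.
have xy : x != y by apply: contraNneq (pq x) => xy; rewrite pxqy xy.
exists [:: x; p x; y; q x]; split=> //; split; last first.
  by rewrite /= !andbT; apply/and4P; split; rewrite // ?pxqy // qxpy.
have side a b : (b \in A) = (a \notin A) -> a != b.
  by move=> ab; apply: contra_eq_neq ab => ->; case: (b \in A).
have AE : (x \in A) = (y \in A) by rewrite -[x \in A]negbK -pA pxqy qA negbK.
by rewrite /= !inE !negb_or xy pq !side ?pA ?qA ?negbK -?AE.
Qed.

(** * Augmented cubes and their generalizations *)

Section SubsetSearch.
Variables (T : finType) (e : rel T) (vs : seq T) (k d : nat).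
Hypotheses (symE : symmetric e) (irrE : irreflexive e).
Hypotheses (uniq_vs : uniq vs) (mem_vs : forall x, x \in vs).
Implicit Types s rest : seq T.

Fixpoint edge_count s : nat :=
  if s is x :: s' then count (e x) s' + edge_count s' else 0.

Definition seq_cost s : nat :=
  edge_count s +
  ((count (fun y => (y \notin s) && has (e^~ y) s) vs).+1 - size s).

(* Runs through the extensions of [s] by elements of [rest]. A branch stops as
   soon as [s] spans [d] edges, since their number only grows. The test is not
   written as a disjunction: evaluating [||] by value would not prune. *)
Fixpoint subset_search rest s : bool :=
  if d <= edge_count s then true
  else if rest is x :: rest' then
    subset_search rest' s && subset_search rest' (x :: s)
  else (size s < k) || (d <= seq_cost s).

Lemma card_enumerated (P : pred T) : #|[set x | P x]| = count P vs.
Proof.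
rewrite -size_filter -(card_uniqP (filter_uniq P uniq_vs)).
by apply: eq_card => x; rewrite inE mem_filter mem_vs andbT.
Qed.

Lemma edge_countE s : uniq s -> edge_count s = #|induced_edges e [set x in s]|.
Proof.
elim: s => [_|x s IHs /= /andP[xs us]].
  apply/esym/eqP; rewrite cards_eq0 -subset0; apply/subsetP=> S.
  by case/induced_edgesP=> x [y []]; rewrite inE.
rewrite set_cons card_induced_edgesU1 ?inE // IHs //; congr (_ + _).
rewrite -size_filter -(card_uniqP (filter_uniq _ us)).
by apply: eq_card => y; rewrite !inE mem_filter andbC.
Qed.

Lemma seq_costE s : uniq s -> seq_cost s = preclusion_cost e setT [set x in s].
Proof.
move=> us; rewrite /seq_cost edge_countE // -card_enumerated.
rewrite -(card_uniqP us) -(cardsE (mem s)); congr (_ + (_.+1 - _)).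
apply: eq_card => y; rewrite !inE andbT; congr (_ && _).
by apply/hasP/exists_inP => -[x xs exy]; exists x; rewrite ?inE // in xs *.
Qed.

Lemma leq_edge_count_catrev t s : edge_count s <= edge_count (catrev t s).
Proof.
elim: t s => //= x t IHt s.
exact: leq_trans (leq_addl _ _) (IHt (x :: s)).
Qed.

Lemma subset_search_sound rest s (P : pred T) (s' := catrev (filter P rest) s) :
  subset_search rest s -> (size s' < k) || (d <= seq_cost s').
Proof.
rewrite {}/s'; elim: rest s => [|x rest IHrest] s /=.
  by case: ifP => // ds _; rewrite (leq_trans ds) ?leq_addr ?orbT.
case: ifP => [ds _|_ /andP[without_x with_x]].
  apply/orP; right; apply: leq_trans (leq_addr _ _).
  exact: leq_trans ds (leq_edge_count_catrev (filter P (x :: rest)) s).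
by case: (P x); apply: IHrest.
Qed.

Lemma robust_search : subset_search vs [::] -> robust e k d setT.
Proof.
move/subset_search_sound=> searched I _ Ik; have := searched (mem I).
rewrite -/(rev _); set s := rev _.
have us : uniq s by rewrite rev_uniq filter_uniq.
have IE : I = [set x in s].
  by apply/setP=> x; rewrite inE mem_rev mem_filter mem_vs andbT.
by rewrite seq_costE // -IE -(card_uniqP us) -cardsE -IE ltnNge Ik.
Qed.

Lemma regular_on_search :
  all (fun x => count (e x) vs == d) vs -> regular_on e d setT.
Proof.
move/allP=> deg x _; rewrite -(eqP (deg x (mem_vs x))) -card_enumerated.
by apply: eq_card => y; rewrite !inE.
Qed.

End SubsetSearch.

Fixpoint all_tuples n : seq (n.-tuple bool) :=
  if n is n'.+1 then
    [seq cons_tuple b t | b <- [:: false; true], t <- all_tuples n']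
  else [:: nil_tuple bool].

Lemma mem_all_tuples n (t : n.-tuple bool) : t \in all_tuples n.
Proof.
elim: n t => [|n IHn] t; first by rewrite tuple0 inE.
by case/tupleP: t => b t; apply: allpairs_f; rewrite ?IHn //; case: b.
Qed.

Lemma uniq_all_tuples n : uniq (all_tuples n).
Proof.
elim: n => // n IHn; apply: allpairs_uniq => // -[b t] [b' t'] _ _ /= [-> tt'].
by congr (_, _); apply: val_inj.
Qed.

Lemma all_differ_sym : symmetric all_differ.
Proof. by elim=> [|a u IHu] [|b v] //=; rewrite eq_sym IHu. Qed.

Lemma aq_sym : symmetric aq.
Proof.
elim=> [|a u IHu] [|b v] //=.
by rewrite eq_sym IHu [u == v]eq_sym all_differ_sym.
Qed.

Lemma aq_irr : irreflexive aq.
Proof. by elim=> [|a u IHu] //=; rewrite eqxx. Qed.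

Lemma AQrel_sym n : symmetric (@AQrel n).
Proof. by move=> x y; apply: aq_sym. Qed.

Lemma AQrel_irr n : irreflexive (@AQrel n).
Proof. by move=> x; apply: aq_irr. Qed.

Lemma AQ4_regular : regular_on (@AQrel 4) 7 setT.
Proof.
apply: (regular_on_search (uniq_all_tuples 4) (@mem_all_tuples 4)).
by vm_compute.
Qed.

Lemma AQ4_robust : robust (@AQrel 4) 2 8 setT.
Proof.
apply: (robust_search (@AQrel_sym 4) (@AQrel_irr 4)
  (uniq_all_tuples 4) (@mem_all_tuples 4)).
by vm_compute.
Qed.

Section AQIsomorphic.
Variables (n : nat) (T : finType) (e : rel T).
Hypothesis isoE : isoAQ n e.

Lemma isoAQ_embedding : exists2 g : n.-tuple bool -> T,
  injective g /\ g @: setT = setT & forall u v, AQrel u v = e (g u) (g v).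
Proof.
case: isoE => f [[g fK gK] eE]; exists g => [|u v]; last by rewrite eE !gK.
split; first exact: can_inj gK.
by apply/setP=> x; rewrite inE; apply/imsetP; exists (f x); rewrite ?fK.
Qed.

Lemma isoAQ_regular d : regular_on (@AQrel n) d setT -> regular_on e d setT.
Proof.
have [g [injg <-] gE] := isoAQ_embedding.
exact: (regular_on_imset injg gE).
Qed.

Lemma isoAQ_robust k d : robust (@AQrel n) k d setT -> robust e k d setT.
Proof.
have [g [injg <-] gE] := isoAQ_embedding.
exact: (robust_imset injg gE).
Qed.

End AQIsomorphic.

Lemma irreflexive_halves (T : finType) (e : rel T) (A : {set T}) :
    irreflexive (Defs.subrel A e) -> irreflexive (Defs.subrel (~: A) e) ->
  irreflexive e.
Proof.
move=> irrA irrA' x; have [xA|] := boolP (x \in A).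
  exact: (irrA (exist _ x xA)).
by rewrite -in_setC => xA; apply: (irrA' (exist _ x xA)).
Qed.

Lemma isGAQ_ge4 n (T : finType) (e : rel T) : isGAQ n e -> 4 <= n.
Proof. by elim=> // {}n *; apply: leqW. Qed.

Lemma isGAQ_sym n (T : finType) (e : rel T) : isGAQ n e -> symmetric e.
Proof. by case=> // {}T {}e [f [_ eE]] x y; rewrite !eE AQrel_sym. Qed.

Lemma isGAQ_irr n (T : finType) (e : rel T) : isGAQ n e -> irreflexive e.
Proof.
elim=> [{}T {}e [f [_ eE]] x|{}n {}T {}e A g1 g2 _ irrA _ irrA' *].
  by rewrite eE AQrel_irr.
exact: irreflexive_halves irrA irrA'.
Qed.

Lemma isGAQ_card n (T : finType) (e : rel T) : isGAQ n e -> #|T| = 2 ^ n.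
Proof.
elim=> [{}T {}e [f [bijf _]]|{}n {}T {}e A g1 g2 _ cardA _ cardA' *].
  by rewrite (bij_eq_card bijf) card_tuple card_bool.
have card_sub (B : {set T}) : #|{: {x : T | x \in B}}| = #|B|.
  by rewrite card_sig.
by rewrite -(cardsC A) -!card_sub cardA cardA' expnS mul2n addnn.
Qed.

Lemma isGAQ_gt0 n (T : finType) (e : rel T) : isGAQ n e -> 0 < #|T|.
Proof. by move/isGAQ_card->; rewrite expn_gt0. Qed.

Lemma isGAQ_regular n (T : finType) (e : rel T) :
  isGAQ n e -> regular_on e (2 * n - 1) setT.
Proof.
elim=> [{}T {}e iso|{}n {}T {}e A g1 g2 GA regA _ regA' bij1 bij2 g12 symE eE].
  exact: (isoAQ_regular iso (@AQ4_regular)).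
have [p [q pqA]] := two_matchings_exist bij1 bij2 g12 symE eE.
have -> : 2 * n.+1 - 1 = (2 * n - 1).+2 by have := isGAQ_ge4 GA; lia.
exact: regular_on_double pqA (regular_on_subrel regA) (regular_on_subrel regA').
Qed.

Lemma isGAQ_robust n (T : finType) (e : rel T) :
  isGAQ n e -> robust e 1 (2 * n - 1) setT.
Proof.
elim=> [{}T {}e iso|{}n {}T {}e A g1 g2 GA robA GA' robA'].
  have G := GAQ_base iso; have rob4 := isoAQ_robust iso (@AQ4_robust).
  exact: (robust_singleton (isGAQ_irr G) (isGAQ_regular G) rob4).
move=> bij1 bij2 g12 symE eE.
have [p [q pqA]] := two_matchings_exist bij1 bij2 g12 symE eE.
have irrE := irreflexive_halves (isGAQ_irr GA) (isGAQ_irr GA').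
have n_ge4 := isGAQ_ge4 GA; have d_gt5 : 5 < 2 * n - 1 by lia.
have -> : 2 * n.+1 - 1 = (2 * n - 1).+2 by lia.
exact: (robust_double symE irrE pqA d_gt5
  (regular_on_subrel (isGAQ_regular GA)) (regular_on_subrel (isGAQ_regular GA'))
  (robust_subrel robA) (robust_subrel robA')).
Qed.

Lemma isRGAQ_isGAQ n (T : finType) (e : rel T) : isRGAQ n e -> isGAQ n e.
Proof.
case=> [[-> /GAQ_base //]|[m [-> [_ [A [g1 [g2 []]]]]]]].
case=> GA GA' bij1 bij2 g12 [symE [eE _]].
exact: GAQ_step GA GA' bij1 bij2 g12 symE eE.
Qed.

Lemma isRGAQ_robust n (T : finType) (e : rel T) :
  isRGAQ n e -> robust e 2 (2 * n) setT.
Proof.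
move=> G; have irrE := isGAQ_irr (isRGAQ_isGAQ G).
case: G => [[-> iso]|]; first exact: (isoAQ_robust iso (@AQ4_robust)).
case=> m [-> [m_ge4 [A [g1 [g2 []]]]]].
case=> GA GA' bij1 bij2 g12 [symE [eE [no4 _]]].
have [p [q pqA]] := two_matchings_exist bij1 bij2 g12 symE eE.
have d_gt5 : 5 < 2 * m - 1 by lia.
have -> : 2 * m.+1 = (2 * m - 1).+3 by lia.
exact: (robust_double_square_free symE irrE pqA d_gt5
  (regular_on_subrel (isGAQ_regular GA)) (regular_on_subrel (isGAQ_regular GA'))
  (robust_subrel (isGAQ_robust GA)) (robust_subrel (isGAQ_robust GA'))
  (no_4_cycle_square_free symE pqA no4)).
Qed.

Theorem theorem3p10 (n : nat) (hn : 4 <= n) :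
  (forall (T : finType) (e : rel T), isGAQ n e ->
     frac_strongly_max_matched e /\ fsmp_is e (2 * n - 1)) /\
  (forall (T : finType) (e : rel T), isRGAQ n e ->
     frac_strongly_super_matched e).
Proof.
split=> T e => [G|RG].
  split; first exact: (robust_frac_strongly_max_matched (isGAQ_sym G)
    (isGAQ_irr G) (isGAQ_gt0 G) (isGAQ_regular G) (isGAQ_robust G)).
  exact: (robust_fsmp_is (isGAQ_sym G)
    (isGAQ_irr G) (isGAQ_gt0 G) (isGAQ_regular G) (isGAQ_robust G)).
have G := isRGAQ_isGAQ RG; have robT := isRGAQ_robust RG.
have dE : 2 * n = (2 * n - 1).+1 by lia.
rewrite dE in robT; exact: (robust_frac_strongly_super_matched (isGAQ_sym G)
  (isGAQ_irr G) (isGAQ_gt0 G) (isGAQ_regular G) robT).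
Qed.
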